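(* Let $\phi$ be a sufficiently smooth function on an open set $D\subset\mathbb{R}^2$, let $\kappa=\kappa(x)$ be a function of the independent variable on $I$, and let $L=\frac{d^2}{dx^2}+\kappa(x)$. Consider the first-order ODE $u'(x)=\phi(x,u)$ with associated curvature $\mathcal{K}(x,u)=-(\phi_{xu}+\phi_u^2+\phi\,\phi_{uu})(x,u)$. Then $\mathcal{K}(x,u)=\kappa(x)$ on $D$ if and only if there exists a continuous function $c\colon I\to\mathbb{R}$ such that every solution $u$ of $u'=\phi(x,u)$ with graph in $D$ satisfies $$L(u)=c(x)$$ wherever defined. Equivalently, the solution set of $u'=\phi(x,u)$ is contained in the affine space $S:=u_p+V$, where $V:=\ker L$ and $u_p$ is any particular solution of $L(u)=c(x)$.
   Context: $L(u)=u''+\kappa(x)u$, and $V=\ker L$ is the two-dimensional space of solutions of $y''+\kappa(x)y=0$. $I$ is the open $x$-interval over which $D$ lies (the projection of $D$ to the $x$-axis). Solutions of the first-order ODE may be defined on subintervals of $I$; containment in $S$ means that they agree there with elements of $S$. Subscripts denote partial derivatives. The curvature $\mathcal{K}=-\partial_u(\phi_x+\phi\,\phi_u)$ is the Gauss curvature of the metric $(1+\phi^2)\,dx\otimes dx-\phi\,dx\otimes du-\phi\,du\otimes dx+du\otimes du$ on $D$. Standing assumptions: $\phi$ is sufficiently smooth on the open set $D$; for every $x$ the fiber $D_x=\{u\in\mathbb{R}:(x,u)\in D\}$ is connected (possibly empty or unbounded). Assertions are local: $D$ and the intervals of definition may be shrunk so that all quantities are defined and sufficiently smooth. *)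

(* Defs.v *)
(* Functions on a subset of R or R^2 are represented by total functions of which
   only the values on that subset matter. *)
From Stdlib Require Import Reals.
From Coquelicot Require Export Coquelicot.
Open Scope R_scope.

Definition C2_on (D : R * R -> Prop) (phi : R -> R -> R) : Prop :=
  forall x u, D (x, u) -> ex_diff_n phi 2 x u.

Definition partial_x (phi : R -> R -> R) (x u : R) : R :=
  Derive (fun t => phi t u) x.

Definition partial_u (phi : R -> R -> R) (x u : R) : R :=
  Derive (fun t => phi x t) u.

(* [phi_xu] is read as (phi_x)_u. *)
Definition curvature (phi : R -> R -> R) (x u : R) : R :=
  - (partial_u (partial_x phi) x u
     + partial_u phi x u ^ 2
     + phi x u * partial_u (partial_u phi) x u).

Definition proj_x (D : R * R -> Prop) (x : R) : Prop := exists u, D (x, u).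

Definition continuous_on_open (I : R -> Prop) (c : R -> R) : Prop :=
  forall x, I x -> continuous c x.

(* [J] is an open interval, possibly unbounded. *)
Definition is_solution (D : R * R -> Prop) (phi : R -> R -> R)
    (J : R -> Prop) (u : R -> R) : Prop :=
  open J /\ is_connected J /\
  forall x, J x -> D (x, u x) /\ is_derive u x (phi x (u x)).

Definition L (kappa u : R -> R) (x : R) : R :=
  Derive_n u 2 x + kappa x * u x.

(* Differentiability is required explicitly because [Derive_n] is total;
   [ex_derive_n u 2 x] only says that [Derive u] is differentiable at [x]. *)
Definition L_eq (kappa c : R -> R) (J : R -> Prop) (u : R -> R) : Prop :=
  forall x, J x ->
    ex_derive u x /\ ex_derive_n u 2 x /\ L kappa u x = c x.

Definition ker_L (kappa : R -> R) (I : R -> Prop) (v : R -> R) : Prop :=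
  L_eq kappa (fun _ => 0) I v.

Definition affine_S (kappa : R -> R) (I : R -> Prop) (up w : R -> R) : Prop :=
  exists v, ker_L kappa I v /\ forall x, I x -> w x = up x + v x.

(* A solution defined on a subinterval J of I lies in S when it agrees on J
   with an element of S. *)
Definition solutions_in_S (D : R * R -> Prop) (phi : R -> R -> R)
    (kappa up : R -> R) : Prop :=
  forall J u, is_solution D phi J u ->
    exists w, affine_S kappa (proj_x D) up w /\ forall x, J x -> u x = w x.

(* Main.v *)
Require Import Defs.
From Stdlib Require Import Arith Reals Lra Lia Classical ClassicalEpsilon.
From Coquelicot Require Import Coquelicot.
Open Scope R_scope.

(** Along a solution [u'' = phi_x + phi phi_u], and the [u]-derivative of
    [phi_x + phi phi_u] is minus the curvature. Since a solution passes through every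
    point of [D], "every solution satisfies [L u = c]" therefore means that
    [phi_x + phi phi_u + kappa(x) u] equals [c(x)] on [D], that is, that it does not
    depend on [u]. Membership in [S] is then the global existence and the uniqueness
    of solutions of [y'' + kappa y = c]. Both existence results come from Picard
    iteration for an abstract Volterra operator. *)

(** * Growth estimates and Picard iteration for Volterra operators *)

(** The mean value theorem replaces integration of the bound. With [d] the distance from [x0] to
    [x], the function C d^(n+1) s^(n+1) / (n+1) - sg f(x0 + s (x - x0)) has nonnegative derivative
    on [0,1] for both signs [sg]. For n = 0 this is the mean value inequality. *)
Lemma abs_increment_le_pow (f df : R -> R) (x0 x C : R) (n : nat) :
  (forall y, Rmin x0 x <= y <= Rmax x0 x ->
     is_derive f y (df y) /\ Rabs (df y) <= C * Rabs (y - x0) ^ n) ->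
  Rabs (f x - f x0) <= C * Rabs (x - x0) ^ S n / INR (S n).
Proof.
  intros H.
  set (d := Rabs (x - x0)).
  assert (HN : INR (S n) <> 0) by (apply not_0_INR; lia).
  assert (seg : forall s, 0 <= s <= 1 ->
            Rmin x0 x <= x0 + s * (x - x0) <= Rmax x0 x).
  { intros s Hs; unfold Rmin, Rmax; destruct (Rle_dec x0 x); nra. }
  assert (one_sided : forall sg, Rabs sg = 1 ->
            sg * (f x - f x0) <= C * d ^ S n / INR (S n)).
  { intros sg Hsg.
    set (g := fun s => C * d ^ S n / INR (S n) * s ^ S n
                       - sg * f (x0 + s * (x - x0))).
    set (dg := fun s => C * d ^ S n * s ^ n
                        - sg * ((x - x0) * df (x0 + s * (x - x0)))).
    assert (Dg : forall s, 0 <= s <= 1 -> is_derive g s (dg s)).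
    { intros s Hs. destruct (H _ (seg s Hs)) as [Df _].
      unfold g, dg. apply @is_derive_minus.
      - replace (C * d ^ S n * s ^ n)
          with (C * d ^ S n / INR (S n) * (INR (S n) * 1 * s ^ pred (S n))).
        + apply is_derive_scal. apply is_derive_pow. apply @is_derive_id.
        + simpl pred. field. exact HN.
      - apply is_derive_scal.
        apply (is_derive_comp f (fun s => x0 + s * (x - x0))); [exact Df|].
        auto_derive; [exact I|ring]. }
    destruct (MVT_gen g 0 1 dg) as [s [Hs E]].
    { intros s; rewrite Rmin_left, Rmax_right by lra; intros; apply Dg; lra. }
    { intros s; rewrite Rmin_left, Rmax_right by lra; intros.
      apply continuity_pt_filterlim, @ex_derive_continuous.
      eexists; apply Dg; lra. }
    rewrite Rmin_left, Rmax_right in Hs by lra.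
    assert (0 <= dg s).
    { destruct (H _ (seg s Hs)) as [_ B].
      replace (x0 + s * (x - x0) - x0) with (s * (x - x0)) in B by ring.
      rewrite Rabs_mult, (Rabs_pos_eq s), Rpow_mult_distr in B by lra.
      fold d in B.
      assert (Rabs (sg * ((x - x0) * df (x0 + s * (x - x0))))
              <= C * d ^ S n * s ^ n).
      { rewrite !Rabs_mult, Hsg. fold d. simpl.
        apply Rle_trans with (1 * (d * (C * (s ^ n * d ^ n)))).
        - rewrite !Rmult_1_l.
          apply Rmult_le_compat_l; [apply Rabs_pos|exact B].
        - right; ring. }
      apply Rabs_le_between in H0. unfold dg. lra. }
    unfold g in E.
    replace (x0 + 1 * (x - x0)) with x in E by ring.
    replace (x0 + 0 * (x - x0)) with x0 in E by ring.
    rewrite pow1, pow_i in E by lia. lra. }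
  apply Rabs_le. split.
  - assert (A := one_sided (-1) ltac:(rewrite Rabs_left; lra)). fold d. lra.
  - assert (A := one_sided 1 Rabs_R1). fold d. lra.
Qed.

Lemma exp_term_lim (q : R) : is_lim_seq (fun n => q ^ n / INR (fact n)) 0.
Proof.
  apply ex_series_lim_0. exists (exp q).
  generalize (proj1 (is_pseries_R _ _ _) (is_exp_Reals q)).
  apply is_series_ext. intros n. apply Rmult_comm.
Qed.

Lemma exp_partial_sums (C q : R) :
  exists s : nat -> R, (forall n, s (S n) - s n = C * (q ^ n / INR (fact n))) /\
    exists l : R, is_lim_seq s l.
Proof.
  set (a := fun n => q ^ n / INR (fact n)).
  (* [sum_n a n] includes the index n; removing [a n] leaves the indices below n, so that the
     increment from n to n+1 is exactly the n-th term. *)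
  exists (fun n => C * (sum_n a n - a n)). split.
  - intros n. rewrite sum_Sn. change plus with Rplus. fold (a n). ring.
  - exists (C * (exp q - 0)).
    apply (is_lim_seq_scal_l _ C (exp q - 0)).
    apply is_lim_seq_minus'; [|apply exp_term_lim].
    change (is_series a (exp q)).
    generalize (proj1 (is_pseries_R _ _ _) (is_exp_Reals q)).
    apply is_series_ext. intros n. apply Rmult_comm.
Qed.

(** Telescoping gives |u_m - u_n| <= s_m - s_n for n <= m. Hence [u] is Cauchy because [s] is, and
    letting m tend to infinity gives the error bound. *)
Lemma lim_of_dominated_increments (u s : nat -> R) (l : R) :
  (forall n, Rabs (u (S n) - u n) <= s (S n) - s n) -> is_lim_seq s l ->
  forall n, Rabs (real (Lim_seq u) - u n) <= l - s n.
Proof.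
  intros H Hs.
  assert (A : forall n m, (n <= m)%nat -> Rabs (u m - u n) <= s m - s n).
  { intros n m L. induction L.
    - rewrite !Rminus_diag, Rabs_R0. lra.
    - specialize (H m).
      replace (u (S m) - u n) with ((u (S m) - u m) + (u m - u n)) by ring.
      eapply Rle_trans; [apply Rabs_triang|lra]. }
  assert (Hl : is_lim_seq u (real (Lim_seq u))).
  { apply Lim_seq_correct'.
    apply ex_lim_seq_cauchy_corr. intros eps.
    assert (E : ex_finite_lim_seq s) by (exists l; exact Hs).
    apply ex_lim_seq_cauchy_corr in E. destruct (E eps) as [N HN].
    exists N. intros n m Hn Hm.
    destruct (Nat.le_gt_cases n m) as [L|L].
    - rewrite Rabs_minus_sym. eapply Rle_lt_trans; [apply A, L|].
      specialize (HN m n Hm Hn). apply Rabs_lt_between in HN. lra.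
    - eapply Rle_lt_trans; [apply A; lia|].
      specialize (HN n m Hn Hm). apply Rabs_lt_between in HN. lra. }
  intros n.
  apply (is_lim_seq_le_loc (fun m => Rabs (u m - u n)) (fun m => s m - s n)
           (Rabs (real (Lim_seq u) - u n)) (l - s n)).
  - exists n. intros m L. apply A, L.
  - apply (is_lim_seq_abs (fun m => u m - u n) (real (Lim_seq u) - u n)).
    apply is_lim_seq_minus'; [exact Hl|apply is_lim_seq_const].
  - apply is_lim_seq_minus'; [exact Hs|apply is_lim_seq_const].
Qed.

(* Stated through powers of [|y - x0|], the Lipschitz condition survives iteration
   directly and yields the bound [K^n |y - x0|^n / n!] without any integral. *)
Definition volterra (I : R -> Prop) (x0 : R) (T : (R -> R) -> R -> R) : Prop :=
  (forall u, continuous_on_open I u -> continuous_on_open I (T u)) /\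
  forall a b, I a -> I b -> a <= x0 <= b ->
  exists K, 0 <= K /\
    forall u v C n, continuous_on_open I u -> continuous_on_open I v ->
    (forall y, a <= y <= b -> Rabs (u y - v y) <= C * Rabs (y - x0) ^ n) ->
    forall y, a <= y <= b ->
      Rabs (T u y - T v y) <= K * C * Rabs (y - x0) ^ S n / INR (S n).

Lemma continuous_bounded (f : R -> R) (a b : R) :
  (forall x, a <= x <= b -> continuous f x) ->
  exists M, 0 <= M /\ forall x, a <= x <= b -> Rabs (f x) <= M.
Proof.
  intros H. destruct (bounded_continuity f a b H) as [M HM].
  exists (Rabs M). split; [apply Rabs_pos|].
  intros x Hx. apply Rle_trans with M; [left; apply (HM x Hx)|apply Rle_abs].
Qed.

(** Successive iterates differ by at most C K^n |y - x0|^n / n!, a term of an exponential series.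
    The pointwise limit [u] is one function on all of [I]; only the rate [r] depends on the compact
    interval, through its constants [K] and [C]. *)
Lemma picard_uniform_limit (I : R -> Prop) (x0 : R) (T : (R -> R) -> R -> R)
    (I_conn : is_connected I) (HT : volterra I x0 T) :
  exists (w : nat -> R -> R) (u : R -> R),
    (forall n, continuous_on_open I (w n)) /\
    (forall n y, w (S n) y = T (w n) y) /\
    forall a b, I a -> I b -> a <= x0 <= b ->
    exists r : nat -> R, is_lim_seq r 0 /\
      forall n y, a <= y <= b -> Rabs (u y - w n y) <= r n.
Proof.
  destruct HT as [HT HL].
  set (w := fix w n := match n with O => fun _ => 0 | S n => T (w n) end).
  assert (wc : forall n, continuous_on_open I (w n)).
  { induction n; [intros x _; apply continuous_const|apply HT, IHn]. }
  exists w, (fun y => real (Lim_seq (fun n => w n y))).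
  split; [exact wc|split; [reflexivity|]].
  intros a b Ia Ib Hab.
  destruct (HL a b Ia Ib Hab) as [K [HK LK]].
  (* [C] bounds the first Picard increment and starts the induction on n. *)
  destruct (continuous_bounded (fun y => w 1%nat y - w O y) a b) as [C [HC BC]].
  { intros y Hy. apply (continuous_minus (w 1%nat) (w O)); apply wc, (I_conn a b); auto. }
  assert (B : forall n y, a <= y <= b ->
    Rabs (w (S n) y - w n y) <= C * (K ^ n / INR (fact n)) * Rabs (y - x0) ^ n).
  { induction n; intros y Hy.
    - simpl pow. simpl fact. simpl INR. replace (C * (1 / 1) * 1) with C by field.
      apply BC, Hy.
    - eapply Rle_trans; [apply (LK (w (S n)) (w n) _ n (wc _) (wc _) IHn y Hy)|].
      right. change (fact (S n)) with (S n * fact n)%nat. rewrite mult_INR.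
      simpl pow. field. split; [apply INR_fact_neq_0|apply not_0_INR; lia]. }
  destruct (exp_partial_sums C (K * (b - a))) as [s [Hs [l Hl]]].
  (* The rate is the tail of the exponential majorant, taken at the largest possible distance b -
     a. *)
  exists (fun n => l - s n). split.
  - replace (Finite 0) with (Finite (l - l)) by (f_equal; ring).
    apply is_lim_seq_minus'; [apply is_lim_seq_const|exact Hl].
  - intros n y Hy.
    apply (lim_of_dominated_increments (fun n => w n y) s l); [|exact Hl].
    intros m. rewrite Hs. eapply Rle_trans; [apply B, Hy|].
    rewrite Rpow_mult_distr.
    replace (C * (K ^ m * (b - a) ^ m / INR (fact m)))
      with (C * (K ^ m / INR (fact m)) * (b - a) ^ m) by (unfold Rdiv; ring).
    apply Rmult_le_compat_l.
    + apply Rmult_le_pos; [exact HC|]. apply Rmult_le_pos; [apply pow_le, HK|].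
      left; apply Rinv_0_lt_compat, INR_fact_lt_0.
    + apply pow_incr. split; [apply Rabs_pos|apply Rabs_le; lra].
Qed.

(** The Volterra estimates hold on compact intervals containing [x0], whereas continuity at [x]
    needs a whole neighbourhood of [x]; [a,b] serves both. *)
Lemma open_interval_around (I : R -> Prop) (x0 x : R) :
  open I -> I x0 -> I x ->
  exists a b, I a /\ I b /\ a <= x0 <= b /\ a < x < b.
Proof.
  intros Io I0 Ix. destruct (Io x Ix) as [e He].
  assert (Hm : I (x - e / 2) /\ I (x + e / 2)).
  { assert (0 < e) by apply cond_pos.
    split; apply He; unfold ball; simpl; unfold AbsRing_ball, abs, minus, plus, opp;
      simpl; apply Rabs_lt_between; lra. }
  assert (0 < e) by apply cond_pos.
  exists (Rmin x0 (x - e / 2)), (Rmax x0 (x + e / 2)).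
  unfold Rmin, Rmax.
  destruct (Rle_dec x0 (x - e / 2)), (Rle_dec x0 (x + e / 2)); repeat split; try tauto; lra.
Qed.

(** The limit of the Picard iterates is continuous by locally uniform convergence, and the Lipschitz
    bound lets [T] pass to the limit. *)
Lemma volterra_fixpoint (I : R -> Prop) (x0 : R) (T : (R -> R) -> R -> R) :
  open I -> is_connected I -> I x0 -> volterra I x0 T ->
  exists u, continuous_on_open I u /\ forall x, I x -> u x = T u x.
Proof.
  intros Io Ic I0 HT.
  destruct (picard_uniform_limit I x0 T Ic HT) as [w [u [wc [wS Hu]]]].
  exists u.
  assert (uc : continuous_on_open I u).
  { intros x Ix.
    destruct (open_interval_around I x0 x Io I0 Ix) as [a [b [Ia [Ib [Hab Hx]]]]].
    destruct (Hu a b Ia Ib Hab) as [r [Hr Br]].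
    apply filterlim_locally. intros eps.
    apply is_lim_seq_spec in Hr.
    (* Three errors of eps/3: u against w_n at [y], w_n between [y] and [x], and w_n against u at
       [x]. *)
    assert (e3 : 0 < eps / 3) by (generalize (cond_pos eps); lra).
    destruct (Hr (mkposreal _ e3)) as [n Hn]. simpl in Hn.
    specialize (Hn n (le_n _)). rewrite Rminus_0_r in Hn.
    apply Rabs_lt_between in Hn.
    assert (W := proj1 (filterlim_locally _ _) (wc n x Ix) (mkposreal _ e3)).
    assert (Dx : 0 < Rmin (x - a) (b - x)) by (apply Rmin_pos; lra).
    generalize (filter_and _ _ W (locally_ball x (mkposreal _ Dx))).
    apply filter_imp. intros y [W1 W2].
    unfold ball in *; simpl in *. unfold AbsRing_ball, abs, minus, plus, opp in *.
    simpl in *.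
    assert (Hy : a <= y <= b).
    { apply Rabs_lt_between in W2.
      assert (L1 := Rmin_l (x - a) (b - x)). assert (L2 := Rmin_r (x - a) (b - x)). lra. }
    assert (B1 := Br n y Hy). assert (B2 := Br n x ltac:(lra)).
    apply Rabs_le_between in B1. apply Rabs_le_between in B2.
    apply Rabs_lt_between in W1. apply Rabs_lt_between. lra. }
  split; [exact uc|].
  intros x Ix.
  destruct (open_interval_around I x0 x Io I0 Ix) as [a [b [Ia [Ib [Hab Hx]]]]].
  destruct (Hu a b Ia Ib Hab) as [r [Hr Br]].
  destruct (proj2 HT a b Ia Ib Hab) as [K [HK LK]].
  assert (Z : Rabs (u x - T u x) <= 0).
  { assert (Q : forall n, Rabs (u x - T u x) <= r (S n) + K * Rabs (x - x0) * r n).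
    { intros n.
      assert (B1 := Br (S n) x ltac:(lra)). rewrite wS in B1.
      assert (B2 := LK u (w n) (r n) O uc (wc n)).
      assert (B3 := B2 ltac:(intros; rewrite Rmult_1_r; apply Br; assumption) x ltac:(lra)).
      simpl in B3.
      replace (K * r n * (Rabs (x - x0) * 1) / 1) with (K * Rabs (x - x0) * r n) in B3
        by field.
      rewrite Rabs_minus_sym in B3.
      replace (u x - T u x) with ((u x - T (w n) x) + (T (w n) x - T u x)) by ring.
      eapply Rle_trans; [apply Rabs_triang|lra]. }
    change (Rbar_le (Rabs (u x - T u x)) 0).
    apply (is_lim_seq_le (fun _ => Rabs (u x - T u x))
             (fun n => r (S n) + K * Rabs (x - x0) * r n) _ 0 Q);
      [apply is_lim_seq_const|].
    replace (Finite 0) with (Finite (0 + K * Rabs (x - x0) * 0)) by (f_equal; ring).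
    apply is_lim_seq_plus'; [apply is_lim_seq_incr_1 in Hr; exact Hr|].
    apply (is_lim_seq_scal_l _ (K * Rabs (x - x0)) 0 Hr). }
  assert (P := Rabs_pos (u x - T u x)).
  destruct (Req_dec (u x - T u x) 0) as [E|E]; [lra|].
  apply Rabs_pos_lt in E. lra.
Qed.

(** * The linear equation y'' + kappa y = c: uniqueness and global existence *)

Lemma is_derive_RInt_on (I : R -> Prop) (x0 : R) (f : R -> R) :
  open I -> is_connected I -> I x0 -> continuous_on_open I f ->
  forall x, I x -> is_derive (fun y => RInt f x0 y) x (f x).
Proof.
  intros Io Ic I0 Hf x Ix.
  apply (is_derive_RInt f _ x0); [|apply Hf, Ix].
  generalize (Io x Ix). apply filter_imp. intros y Iy.
  apply @RInt_correct, ex_RInt_continuous. intros z Hz. apply Hf.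
  revert Hz. unfold Rmin, Rmax. destruct (Rle_dec x0 y); intros Hz.
  - apply (Ic x0 y); auto.
  - apply (Ic y x0); auto.
Qed.

Lemma is_derive_continuous_on (I : R -> Prop) (f df : R -> R) :
  (forall x, I x -> is_derive f x (df x)) -> continuous_on_open I f.
Proof.
  intros H x Ix. apply @ex_derive_continuous. exists (df x). apply H, Ix.
Qed.

(** The first-order estimate is applied twice, to z = w' and then to w. The factor |s - x0| / (n+1)
    gained for z is coarsened to b - a, so that one power is gained in all, as in [volterra]. *)
Lemma second_order_bound (a b x0 C : R) (n : nat) (w z dz : R -> R) :
  a <= x0 <= b -> w x0 = 0 -> z x0 = 0 ->
  (forall y, a <= y <= b -> is_derive w y (z y) /\ is_derive z y (dz y) /\
     Rabs (dz y) <= C * Rabs (y - x0) ^ n) ->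
  forall y, a <= y <= b ->
    Rabs (w y) <= (b - a) * C * Rabs (y - x0) ^ S n / INR (S n).
Proof.
  intros Hab W0 Z0 H.
  assert (seg : forall x y, a <= x <= b -> Rmin x0 x <= y <= Rmax x0 x -> a <= y <= b).
  { intros x y Hx. unfold Rmin, Rmax. destruct (Rle_dec x0 x); lra. }
  intros y Hy. replace (w y) with (w y - w x0) by lra.
  apply (abs_increment_le_pow w z). intros s Hs.
  assert (Hs' := seg y s Hy Hs). destruct (H s Hs') as [Dw [Dz B]].
  split; [exact Dw|].
  replace (z s) with (z s - z x0) by lra.
  eapply Rle_trans.
  { apply (abs_increment_le_pow z dz x0 s C n). intros t Ht.
    destruct (H t (seg s t Hs' Ht)) as [_ Q]. exact Q. }
  replace (C * Rabs (s - x0) ^ S n / INR (S n))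
    with (C * Rabs (s - x0) ^ n * (Rabs (s - x0) * / INR (S n)))
    by (simpl pow; unfold Rdiv; ring).
  replace ((b - a) * C * Rabs (s - x0) ^ n)
    with (C * Rabs (s - x0) ^ n * ((b - a) * 1)) by ring.
  apply Rmult_le_compat_l.
  - eapply Rle_trans; [apply Rabs_pos|exact B].
  - apply Rmult_le_compat.
    + apply Rabs_pos.
    + left. apply Rinv_0_lt_compat, lt_0_INR. lia.
    + apply Rabs_le. lra.
    + rewrite <- Rinv_1. apply Rinv_le_contravar; [lra|].
      rewrite S_INR. generalize (pos_INR n). lra.
Qed.

(** A bound on [w] over a compact interval improves itself: it bounds w'' = - kappa w, and
    [second_order_bound] returns a better bound on [w]. After n rounds it is C ((b - a) M)^n |y -
    x0|^n / n!, which tends to 0. *)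
Lemma linear_unique (J : R -> Prop) (x0 : R) (kappa w z : R -> R) :
  is_connected J -> J x0 -> continuous_on_open J kappa ->
  w x0 = 0 -> z x0 = 0 ->
  (forall x, J x -> is_derive w x (z x) /\ is_derive z x (- kappa x * w x)) ->
  forall x, J x -> w x = 0.
Proof.
  intros Jc J0 Hk W0 Z0 H x Jx.
  set (a := Rmin x0 x). set (b := Rmax x0 x).
  assert (Hab : a <= x0 <= b) by (split; [apply Rmin_l|apply Rmax_l]).
  assert (Hx : a <= x <= b) by (split; [apply Rmin_r|apply Rmax_r]).
  assert (Jab : forall y, a <= y <= b -> J y).
  { intros y. unfold a, b, Rmin, Rmax. destruct (Rle_dec x0 x); intros Hy.
    - apply (Jc x0 x); auto.
    - apply (Jc x x0); auto. }
  destruct (continuous_bounded kappa a b) as [M [HM BM]].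
  { intros y Hy. apply Hk, Jab, Hy. }
  destruct (continuous_bounded w a b) as [C [HC BC]].
  { intros y Hy. apply (is_derive_continuous_on J w z); [|apply Jab, Hy].
    intros t Jt. apply H, Jt. }
  assert (B : forall n y, a <= y <= b ->
    Rabs (w y) <= C * (((b - a) * M) ^ n / INR (fact n)) * Rabs (y - x0) ^ n).
  { induction n; intros y Hy.
    - simpl pow. simpl fact. simpl INR. replace (C * (1 / 1) * 1) with C by field.
      apply BC, Hy.
    - eapply Rle_trans.
      + apply (second_order_bound a b x0
                 (M * (C * (((b - a) * M) ^ n / INR (fact n)))) n w z
                 (fun t => - kappa t * w t) Hab W0 Z0); [|exact Hy].
        intros t Ht. destruct (H t (Jab t Ht)) as [H1 H2].
        split; [exact H1|split; [exact H2|]].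
        rewrite Rabs_mult, Rabs_Ropp, Rmult_assoc.
        apply Rmult_le_compat; try apply Rabs_pos; [apply BM, Ht|apply IHn, Ht].
      + right. change (fact (S n)) with (S n * fact n)%nat. rewrite mult_INR.
        simpl pow. field. split; [apply INR_fact_neq_0|apply not_0_INR; lia]. }
  assert (Z : Rbar_le (Rabs (w x)) 0).
  { set (q := (b - a) * M * Rabs (x - x0)).
    apply (is_lim_seq_le (fun _ => Rabs (w x)) (fun n => C * (q ^ n / INR (fact n)))).
    - intros n. eapply Rle_trans; [apply (B n x Hx)|].
      right. unfold q. rewrite (Rpow_mult_distr _ (Rabs (x - x0))). unfold Rdiv. ring.
    - apply is_lim_seq_const.
    - replace (Finite 0) with (Rbar_mult C 0) by (simpl; f_equal; ring).
      apply is_lim_seq_scal_l, exp_term_lim. }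
  simpl in Z. assert (P := Rabs_pos (w x)).
  destruct (Req_dec (w x) 0) as [E|E]; [exact E|].
  apply Rabs_pos_lt in E. lra.
Qed.

(** [Derive u] agrees with [z] on the open set [J], hence near each of its points, so the two have
    the same derivative there. *)
Lemma L_eq_intro (kappa c : R -> R) (J : R -> Prop) (u z : R -> R) :
  open J ->
  (forall x, J x -> is_derive u x (z x) /\ is_derive z x (c x - kappa x * u x)) ->
  L_eq kappa c J u.
Proof.
  intros Jo H x Jx.
  assert (Dz : is_derive (Derive u) x (c x - kappa x * u x)).
  { apply (is_derive_ext_loc z); [|apply H, Jx].
    generalize (Jo x Jx). apply filter_imp. intros y Jy.
    symmetry. apply is_derive_unique, H, Jy. }
  split; [exists (z x); apply H, Jx|].
  split; [exists (c x - kappa x * u x); exact Dz|].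
  change (Derive (Derive u) x + kappa x * u x = c x).
  rewrite (is_derive_unique _ _ _ Dz). ring.
Qed.

Lemma L_eq_elim (kappa c : R -> R) (J : R -> Prop) (u : R -> R) :
  L_eq kappa c J u -> forall x, J x ->
  is_derive u x (Derive u x) /\ is_derive (Derive u) x (c x - kappa x * u x).
Proof.
  intros H x Jx. destruct (H x Jx) as [H1 [H2 H3]].
  split; [apply Derive_correct, H1|].
  unfold L in H3.
  replace (c x - kappa x * u x) with (Derive_n u 2 x) by lra.
  apply (Derive_correct (Derive_n u 1)), H2.
Qed.

(** Solutions with data [al], [be] at [x0] are the fixed points of [T], which integrates c - kappa u
    twice. Linearity makes [T] Lipschitz on every compact subinterval without bounding u, so the
    solution lives on all of [I]. *)
Lemma linear_exists (I : R -> Prop) (kappa c : R -> R) (x0 al be : R) :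
  open I -> is_connected I -> I x0 ->
  continuous_on_open I kappa -> continuous_on_open I c ->
  exists u, L_eq kappa c I u /\ u x0 = al /\ Derive u x0 = be.
Proof.
  intros Io Ic I0 Hk Hc.
  set (G := fun (u : R -> R) t => RInt (fun s => c s - kappa s * u s) x0 t).
  set (T := fun (u : R -> R) x => al + be * (x - x0) + RInt (G u) x0 x).
  assert (DG : forall u, continuous_on_open I u -> forall x, I x ->
            is_derive (G u) x (c x - kappa x * u x)).
  { intros u Hu. apply (is_derive_RInt_on I x0 (fun s => c s - kappa s * u s)); auto.
    intros x Ix.
    apply (continuous_minus c (fun s => kappa s * u s)); [apply Hc, Ix|].
    apply (continuous_mult kappa u); [apply Hk, Ix|apply Hu, Ix]. }
  assert (DT : forall u, continuous_on_open I u -> forall x, I x ->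
            is_derive (T u) x (be + G u x)).
  { intros u Hu x Ix. unfold T.
    apply @is_derive_plus.
    - auto_derive; [exact Logic.I|ring].
    - apply (is_derive_RInt_on I); auto.
      apply (is_derive_continuous_on I _ _ (DG u Hu)). }
  assert (G0 : forall u, G u x0 = 0) by (intros u; apply @RInt_point).
  assert (T0 : forall u, T u x0 = al).
  { intros u. unfold T. replace (RInt (G u) x0 x0) with 0; [ring|].
    symmetry. apply @RInt_point. }
  assert (V : volterra I x0 T).
  { split.
    - intros u Hu. apply (is_derive_continuous_on I _ _ (DT u Hu)).
    - intros a b Ia Ib Hab.
      destruct (continuous_bounded kappa a b) as [M [HM BM]].
      { intros y Hy. apply Hk, (Ic a b); auto. }
      (* [c] cancels in T u - T v, whose second derivative is - kappa (u - v); [M] bounds kappa, and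
         b - a comes from the inner integration. *)
      exists ((b - a) * M). split; [apply Rmult_le_pos; lra|].
      intros u v C n Hu Hv B y Hy.
      rewrite (Rmult_assoc (b - a)).
      apply (second_order_bound a b x0 (M * C) n (fun t => T u t - T v t)
               (fun t => G u t - G v t) (fun t => - kappa t * (u t - v t))); auto.
      + rewrite !T0. ring.
      + rewrite !G0. ring.
      + intros t Ht. assert (It : I t) by (apply (Ic a b); auto).
        split; [|split].
        * replace (G u t - G v t) with (minus (be + G u t) (be + G v t))
            by (unfold minus, plus, opp; simpl; ring).
          apply @is_derive_minus; apply DT; auto.
        * replace (- kappa t * (u t - v t))
            with (minus (c t - kappa t * u t) (c t - kappa t * v t))
            by (unfold minus, plus, opp; simpl; ring).
          apply @is_derive_minus; apply DG; auto.
        * rewrite Rabs_mult, Rabs_Ropp, Rmult_assoc.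
          apply Rmult_le_compat; try apply Rabs_pos; [apply BM, Ht|apply B, Ht]. }
  destruct (volterra_fixpoint I x0 T Io Ic I0 V) as [u [Hu E]].
  assert (Du : forall x, I x -> is_derive u x (be + G u x)).
  { intros x Ix. apply (is_derive_ext_loc (T u)); [|apply DT; auto].
    generalize (Io x Ix). apply filter_imp. intros y Iy. symmetry. apply E, Iy. }
  exists u. split; [|split].
  - apply (L_eq_intro _ _ _ _ (fun x => be + G u x) Io).
    intros x Ix. split; [apply Du, Ix|].
    rewrite <- (Rplus_0_l (c x - kappa x * u x)).
    apply @is_derive_plus; [apply @is_derive_const|apply DG; auto].
  - rewrite E, T0; auto.
  - rewrite (is_derive_unique _ _ _ (Du x0 I0)), G0. ring.
Qed.

(** * Local solutions of u' = phi(x,u) *)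

(* Composing [phi] with [clamp] makes it globally Lipschitz in [u], so that the Picard
   iterates never leave the domain. *)
Definition clamp (u0 r u : R) : R := Rmax (u0 - r) (Rmin (u0 + r) u).

Lemma clamp_spec (u0 r u : R) : 0 <= r ->
  Rabs (clamp u0 r u - u0) <= r /\ (Rabs (u - u0) <= r -> clamp u0 r u = u).
Proof.
  intros Hr. unfold clamp, Rmax, Rmin. split.
  - apply Rabs_le. destruct (Rle_dec (u0 + r) u);
      match goal with |- context [Rle_dec ?p ?q] => destruct (Rle_dec p q) end; lra.
  - intros H. apply Rabs_le_between in H.
    destruct (Rle_dec (u0 + r) u);
      match goal with |- context [Rle_dec ?p ?q] => destruct (Rle_dec p q) end; lra.
Qed.

Lemma clamp_lipschitz (u0 r u v : R) : 0 <= r ->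
  Rabs (clamp u0 r u - clamp u0 r v) <= Rabs (u - v).
Proof.
  intros Hr. unfold clamp, Rmax, Rmin.
  destruct (Rle_dec (u0 + r) u), (Rle_dec (u0 + r) v);
    repeat match goal with |- context [Rle_dec ?p ?q] => destruct (Rle_dec p q) end;
    unfold Rabs; repeat destruct Rcase_abs; lra.
Qed.

Lemma clamp_continuous (u0 r u : R) : 0 <= r -> continuous (clamp u0 r) u.
Proof.
  intros Hr. apply filterlim_locally. intros eps. exists eps. intros v Hv.
  eapply Rle_lt_trans; [apply clamp_lipschitz, Hr|exact Hv].
Qed.

Lemma continuity_2d_pt_bounded (f : R -> R -> R) (x y : R) :
  continuity_2d_pt f x y ->
  exists M, 0 <= M /\ locally_2d (fun u v => Rabs (f u v) <= M) x y.
Proof.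
  intros H. exists (Rabs (f x y) + 1). split.
  - generalize (Rabs_pos (f x y)). lra.
  - destruct (H (mkposreal 1 Rlt_0_1)) as [d Hd]. exists d. intros u v Hu Hv.
    specialize (Hd u v Hu Hv). simpl in Hd.
    replace (f u v) with ((f u v - f x y) + f x y) by ring.
    eapply Rle_trans; [apply Rabs_triang|lra].
Qed.

Lemma open_centered (x0 d : R) : open (fun x => x0 - d < x < x0 + d).
Proof. apply open_and; [apply open_gt|apply open_lt]. Qed.

Lemma connected_centered (x0 d : R) : is_connected (fun x => x0 - d < x < x0 + d).
Proof. intros a b x Ha Hb Hx. lra. Qed.

(** On a box around the point, of half-width [r] and inside [D], |phi| <= M and |phi_u| <= K. The
    clamped equation has a solution over the whole width of the box; closer to [x0] it has not yet
    left the box, and there the clamp is the identity. *)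
Lemma local_solution (D : R * R -> Prop) (phi : R -> R -> R) (x0 u0 : R) :
  open D -> C2_on D phi -> D (x0, u0) ->
  exists J u, is_solution D phi J u /\ J x0 /\ u x0 = u0.
Proof.
  intros Do HC D0.
  destruct (HC x0 u0 D0) as [C0 [_ [_ [_ [C1 _]]]]].
  destruct (continuity_2d_pt_bounded _ _ _ C0) as [M [HM [d1 H1]]].
  destruct (continuity_2d_pt_bounded _ _ _ C1) as [K [HK [d2 H2]]].
  assert (Dl : locally_2d (fun x u => D (x, u)) x0 u0).
  { apply locally_2d_locally. generalize (Do _ D0). apply filter_imp.
    intros [x u] H. exact H. }
  destruct Dl as [d3 H3].
  (* Halving makes the closed box of half-width [r] fit inside the three open neighbourhoods. *)
  set (r := Rmin (Rmin d1 d2) d3 / 2).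
  assert (Hr : 0 < r /\ r < d1 /\ r < d2 /\ r < d3).
  { unfold r. generalize (cond_pos d1) (cond_pos d2) (cond_pos d3).
    unfold Rmin. destruct (Rle_dec d1 d2);
    match goal with |- context [Rle_dec ?p ?q] => destruct (Rle_dec p q) end; lra. }
  clearbody r.
  assert (inD : forall x u, Rabs (x - x0) <= r -> Rabs (u - u0) <= r -> D (x, u))
    by (intros x u Hx Hu; apply H3; lra).
  set (I := fun x => x0 - r < x < x0 + r).
  assert (Ir : forall x, I x -> Rabs (x - x0) <= r)
    by (intros x Ix; apply Rabs_le; unfold I in Ix; lra).
  assert (Io : open I) by apply open_centered.
  assert (Ic : is_connected I) by apply connected_centered.
  assert (I0 : I x0) by (unfold I; lra).
  set (f := fun (u : R -> R) t => phi t (clamp u0 r (u t))).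
  assert (Hf : forall u, continuous_on_open I u -> continuous_on_open I (f u)).
  { intros u Hu t It. unfold f.
    apply (continuous_comp_2 (fun t => t) (fun t => clamp u0 r (u t)) phi).
    - apply continuous_id.
    - apply (continuous_comp u (clamp u0 r)); [apply Hu, It|apply clamp_continuous; lra].
    - apply continuity_2d_pt_filterlim.
      assert (Dt : D (t, clamp u0 r (u t))).
      { apply inD; [apply Ir, It|apply clamp_spec; lra]. }
      destruct (HC _ _ Dt) as [Q _]. exact Q. }
  set (T := fun (u : R -> R) x => u0 + RInt (f u) x0 x).
  assert (DT : forall u, continuous_on_open I u -> forall x, I x ->
            is_derive (T u) x (f u x)).
  { intros u Hu x Ix. unfold T. rewrite <- (Rplus_0_l (f u x)).
    apply @is_derive_plus; [apply @is_derive_const|].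
    apply (is_derive_RInt_on I); auto. }
  assert (T0 : forall u, T u x0 = u0).
  { intros u. unfold T. replace (RInt (f u) x0 x0) with 0; [ring|].
    symmetry. apply @RInt_point. }
  (* Vertical segments stay in the box, so the mean value inequality applies with the bound [K] on
     phi_u. *)
  assert (Lip : forall t p q, Rabs (t - x0) <= r -> Rabs (p - u0) <= r ->
            Rabs (q - u0) <= r -> Rabs (phi t p - phi t q) <= K * Rabs (p - q)).
  { intros t p q Ht Hp Hq.
    replace (K * Rabs (p - q)) with (K * Rabs (p - q) ^ 1 / INR 1) by (simpl; field).
    apply (abs_increment_le_pow (phi t) (partial_u phi t) q p K 0).
    intros y Hy.
    assert (Hy' : Rabs (y - u0) <= r).
    { apply Rabs_le_between in Hp. apply Rabs_le_between in Hq. apply Rabs_le.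
      revert Hy. unfold Rmin, Rmax. destruct (Rle_dec q p); lra. }
    split.
    - apply Derive_correct. destruct (HC t y (inD t y Ht Hy')) as [_ [_ [Q _]]].
      exact Q.
    - simpl. rewrite Rmult_1_r. apply H2; lra. }
  assert (V : volterra I x0 T).
  { split.
    - intros u Hu. apply (is_derive_continuous_on I _ _ (DT u Hu)).
    - intros a b Ia Ib Hab. exists K. split; [exact HK|].
      intros u v C n Hu Hv B y Hy.
      replace (T u y - T v y) with ((T u y - T v y) - (T u x0 - T v x0))
        by (rewrite !T0; ring).
      apply (abs_increment_le_pow (fun t => T u t - T v t) (fun t => f u t - f v t)).
      intros t Ht.
      assert (Ht' : a <= t <= b).
      { revert Ht. unfold Rmin, Rmax. destruct (Rle_dec x0 y); lra. }
      assert (It : I t) by (apply (Ic a b); auto).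
      split; [apply @is_derive_minus; apply DT; auto|].
      unfold f. eapply Rle_trans; [apply Lip; [apply Ir, It|apply clamp_spec; lra..]|].
      rewrite Rmult_assoc. apply Rmult_le_compat_l; [exact HK|].
      eapply Rle_trans; [apply clamp_lipschitz; lra|apply B, Ht']. }
  destruct (volterra_fixpoint I x0 T Io Ic I0 V) as [u [Hu E]].
  assert (Du : forall x, I x -> is_derive u x (f u x)).
  { intros x Ix. apply (is_derive_ext_loc (T u)); [|apply DT; auto].
    generalize (Io x Ix). apply filter_imp. intros y Iy. symmetry. apply E, Iy. }
  (* The slope is at most [M], so within distance [d] the solution moves by at most M d <= r. The
     added 1 covers M = 0 and also gives d <= r. *)
  set (d := r / (M + 1)).
  assert (Hd : 0 < d) by (apply Rdiv_lt_0_compat; lra).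
  assert (HMd : (M + 1) * d = r) by (unfold d; field; lra).
  assert (JI : forall x, x0 - d < x < x0 + d -> I x) by (intros x Hx; unfold I; nra).
  assert (U : forall x, x0 - d < x < x0 + d -> Rabs (u x - u0) <= r).
  { intros x Hx. replace u0 with (u x0) at 1 by (rewrite E, T0; auto).
    apply Rle_trans with (M * Rabs (x - x0) ^ 1 / INR 1).
    - apply (abs_increment_le_pow u (f u) x0 x M 0). intros y Hy.
      assert (Iy : I y).
      { apply JI. revert Hy. unfold Rmin, Rmax. destruct (Rle_dec x0 x); lra. }
      split; [apply Du, Iy|]. simpl. rewrite Rmult_1_r. unfold f.
      assert (P := Ir y Iy).
      assert (Q := proj1 (clamp_spec u0 r (u y) ltac:(lra))).
      apply H1; lra.
    - simpl. assert (Rabs (x - x0) <= d) by (apply Rabs_le; lra). nra. }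
  exists (fun x => x0 - d < x < x0 + d), u.
  split; [split; [apply open_centered|split; [apply connected_centered|]]|split].
  - intros x Hx. split; [apply inD; [apply Ir, JI, Hx|apply U, Hx]|].
    assert (Dx := Du x (JI x Hx)). unfold f in Dx.
    rewrite (proj2 (clamp_spec u0 r (u x) ltac:(lra)) (U x Hx)) in Dx. exact Dx.
  - lra.
  - rewrite E, T0; auto.
Qed.

(** * Second derivatives along solutions, and the curvature *)

(* [u' = phi(x,u)] gives [u'' = second_derivative phi x u]. *)
Definition second_derivative (phi : R -> R -> R) (x u : R) : R :=
  partial_x phi x u + phi x u * partial_u phi x u.

(** The chain rule along (t, u(t)) needs total differentiability. It follows from phi_x existing
    nearby and being continuous at the point, together with phi_u existing at the point. *)
Lemma C2_on_differentiable (D : R * R -> Prop) (phi : R -> R -> R) (x u : R) :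
  open D -> C2_on D phi -> D (x, u) ->
  differentiable_pt_lim phi x u (partial_x phi x u) (partial_u phi x u).
Proof.
  intros Do HC Dxu. apply filterdiff_differentiable_pt_lim.
  destruct (HC x u Dxu) as [_ [_ [Eu [[Cx _] _]]]].
  apply (is_derive_filterdiff phi x u (partial_x phi) (partial_u phi x u)).
  - generalize (Do _ Dxu). apply filter_imp. intros [y v] Dyv.
    destruct (HC y v Dyv) as [_ [Ex _]]. apply Derive_correct, Ex.
  - apply Derive_correct, Eu.
  - apply continuity_2d_pt_filterlim, Cx.
Qed.

(** By the product rule, (phi phi_u)_u = phi_u^2 + phi phi_uu. The mixed term arises as (phi_x)_u,
    the order chosen in [curvature], so no partial derivatives are interchanged. *)
Lemma is_derive_second_derivative (D : R * R -> Prop) (phi : R -> R -> R) (x u : R) :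
  C2_on D phi -> D (x, u) ->
  is_derive (second_derivative phi x) u (- curvature phi x u).
Proof.
  intros HC Dxu.
  destruct (HC x u Dxu) as [_ [_ [E1 [[_ [_ [E2 _]]] [_ [_ [E3 _]]]]]]].
  replace (- curvature phi x u)
    with (partial_u (partial_x phi) x u
          + (partial_u phi x u * partial_u phi x u
             + phi x u * partial_u (partial_u phi) x u))
    by (unfold curvature; ring).
  unfold second_derivative. apply @is_derive_plus; [apply Derive_correct, E2|].
  apply (is_derive_mult (phi x) (partial_u phi x)); [apply Derive_correct, E1|
    apply Derive_correct, E3|apply Rmult_comm].
Qed.

Lemma continuity_2d_pt_slice (f : R -> R -> R) (x u : R) :
  continuity_2d_pt f x u -> continuous (fun t => f t u) x.
Proof.
  intros H. apply (continuous_comp_2 (fun t => t) (fun _ => u) f).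
  - apply continuous_id.
  - apply continuous_const.
  - apply continuity_2d_pt_filterlim, H.
Qed.

Lemma second_derivative_continuous (D : R * R -> Prop) (phi : R -> R -> R) (x u : R) :
  C2_on D phi -> D (x, u) -> continuous (fun t => second_derivative phi t u) x.
Proof.
  intros HC Dxu.
  destruct (HC x u Dxu) as [C0 [_ [_ [[C1 _] [C2 _]]]]].
  apply (continuity_2d_pt_slice (second_derivative phi)).
  apply continuity_2d_pt_plus; [exact C1|].
  apply continuity_2d_pt_mult; [exact C0|exact C2].
Qed.

Lemma curvature_continuous (D : R * R -> Prop) (phi : R -> R -> R) (x u : R) :
  C2_on D phi -> D (x, u) -> continuous (fun t => curvature phi t u) x.
Proof.
  intros HC Dxu.
  destruct (HC x u Dxu) as
    [C0 [_ [_ [[_ [_ [_ [_ [C1 _]]]]] [C2 [_ [_ [_ [C3 _]]]]]]]]].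
  apply (continuity_2d_pt_slice (curvature phi)).
  apply continuity_2d_pt_opp.
  apply continuity_2d_pt_plus; [apply continuity_2d_pt_plus|].
  - exact C1.
  - apply (continuity_2d_pt_ext (fun y v => partial_u phi y v * partial_u phi y v)).
    + intros; ring.
    + apply continuity_2d_pt_mult; exact C2.
  - apply continuity_2d_pt_mult; [exact C0|exact C3].
Qed.

Lemma solution_second_derivative (D : R * R -> Prop) (phi : R -> R -> R)
    (J : R -> Prop) (u : R -> R) (x : R) :
  open D -> C2_on D phi -> is_solution D phi J u -> J x ->
  is_derive (fun t => phi t (u t)) x (second_derivative phi x (u x)).
Proof.
  intros Do HC [_ [_ Hu]] Jx. destruct (Hu x Jx) as [Dx Du].
  unfold second_derivative.
  replace (partial_x phi x (u x) + phi x (u x) * partial_u phi x (u x))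
    with (partial_x phi x (u x) * 1 + partial_u phi x (u x) * phi x (u x)) by ring.
  apply is_derive_Reals, (derivable_pt_lim_comp_2d phi (fun t => t) u).
  - apply (C2_on_differentiable D); auto.
  - apply derivable_pt_lim_id.
  - apply is_derive_Reals, Du.
Qed.

Lemma locally_slices (D : R * R -> Prop) (x u : R) :
  open D -> D (x, u) ->
  locally x (fun t => D (t, u)) /\ locally u (fun v => D (x, v)).
Proof.
  intros Do Dxu. destruct (Do _ Dxu) as [e He].
  split; exists e; intros t Ht; apply He; split; simpl; auto; apply ball_center.
Qed.

Lemma proj_x_open (D : R * R -> Prop) : open D -> open (proj_x D).
Proof.
  intros Do x [u Dxu]. generalize (proj1 (locally_slices D x u Do Dxu)).
  apply filter_imp. intros t Dt. exists u. exact Dt.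
Qed.

(** Forward, the identity at a point is read off from a local solution through it; backward, it is
    evaluated along the given solution. *)
Lemma solutions_L_eq_iff (D : R * R -> Prop) (phi : R -> R -> R)
    (kappa c : R -> R) (D_open : open D) (phi_smooth : C2_on D phi) :
  (forall J u, is_solution D phi J u -> L_eq kappa c J u) <->
  (forall x u, D (x, u) -> second_derivative phi x u + kappa x * u = c x).
Proof.
  split.
  - intros H x u Dxu.
    destruct (local_solution D phi x u D_open phi_smooth Dxu) as [J [y [Hy [Jx Ey]]]].
    destruct (H J y Hy x Jx) as [_ [_ E]].
    rewrite <- E, <- Ey. unfold L. f_equal. symmetry.
    change (Derive (Derive y) x = second_derivative phi x (y x)).
    apply is_derive_unique. apply (is_derive_ext_loc (fun t => phi t (y t))).
    + generalize (proj1 Hy x Jx). apply filter_imp. intros t Jt.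
      symmetry. apply is_derive_unique, (proj2 (proj2 Hy)), Jt.
    + apply (solution_second_derivative D phi J); auto.
  - intros H J u Hu.
    apply (L_eq_intro _ _ _ _ (fun t => phi t (u t)) (proj1 Hu)).
    intros x Jx. destruct (proj2 (proj2 Hu) x Jx) as [Dx Du].
    split; [exact Du|].
    replace (c x - kappa x * u x) with (second_derivative phi x (u x))
      by (rewrite <- (H x (u x) Dx); ring).
    apply (solution_second_derivative D phi J); auto.
Qed.

(** Differentiate the identity in [u] at fixed [x]; it holds for all nearby [u] since [D] is
    open. *)
Lemma curvature_of_identity (D : R * R -> Prop) (phi : R -> R -> R)
    (kappa c : R -> R) (D_open : open D) (phi_smooth : C2_on D phi) :
  (forall x u, D (x, u) -> second_derivative phi x u + kappa x * u = c x) ->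
  forall x u, D (x, u) -> curvature phi x u = kappa x.
Proof.
  intros H x u Dxu.
  assert (E1 := is_derive_second_derivative D phi x u phi_smooth Dxu).
  assert (E2 : is_derive (second_derivative phi x) u (- kappa x)).
  { apply (is_derive_ext_loc (fun v => c x - kappa x * v)).
    - generalize (proj2 (locally_slices D x u D_open Dxu)). apply filter_imp.
      intros v Dv. rewrite <- (H x v Dv). apply Rplus_minus_r.
    - auto_derive; [exact Logic.I|ring]. }
  apply is_derive_unique in E1. apply is_derive_unique in E2. lra.
Qed.

(** Near [x], [kappa] coincides with the curvature along a horizontal slice at fixed height [u],
    which stays in the open set [D]. *)
Lemma kappa_continuous (D : R * R -> Prop) (phi : R -> R -> R)
    (kappa : R -> R) (D_open : open D) (phi_smooth : C2_on D phi) :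
  (forall x u, D (x, u) -> curvature phi x u = kappa x) ->
  continuous_on_open (proj_x D) kappa.
Proof.
  intros H x [u Dxu].
  apply (continuous_ext_loc _ (fun t => curvature phi t u)).
  - generalize (proj1 (locally_slices D x u D_open Dxu)). apply filter_imp.
    intros t Dt. apply H, Dt.
  - apply (curvature_continuous D); auto.
Qed.

(** The [u]-derivative of phi_x + phi phi_u + kappa u is - curvature + kappa = 0, so this expression
    is constant on each connected fiber; the constant is c(x). *)
Lemma identity_of_curvature (D : R * R -> Prop) (phi : R -> R -> R)
    (kappa : R -> R) (D_open : open D)
    (D_fibers : forall x, is_connected (fun u => D (x, u)))
    (phi_smooth : C2_on D phi) :
  (forall x u, D (x, u) -> curvature phi x u = kappa x) ->
  exists c, continuous_on_open (proj_x D) c /\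
    forall x u, D (x, u) -> second_derivative phi x u + kappa x * u = c x.
Proof.
  intros H.
  set (g := fun x u => second_derivative phi x u + kappa x * u).
  assert (lt : forall x u v, D (x, u) -> D (x, v) -> u < v -> g x u = g x v).
  { intros x u v Du Dv Huv. apply (eq_is_derive (g x) u v); [|exact Huv].
    intros t Ht. assert (Dt := D_fibers x u v t Du Dv Ht).
    replace (@zero R_NormedModule) with (- curvature phi x t + kappa x).
    - unfold g. apply @is_derive_plus.
      + apply (is_derive_second_derivative D); auto.
      + rewrite <- (Rmult_1_r (kappa x)) at 2. apply is_derive_scal, @is_derive_id.
    - rewrite (H x t Dt). apply Rplus_opp_l. }
  assert (const : forall x u v, D (x, u) -> D (x, v) -> g x u = g x v).
  { intros x u v Du Dv. destruct (Rtotal_order u v) as [L|[->|L]]; auto.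
    symmetry; auto. }
  (* Choice picks the value of [g x] at some point of the fiber; over an empty fiber the value is
     arbitrary. *)
  set (c := fun x => epsilon (inhabits 0) (fun y => exists u, D (x, u) /\ y = g x u)).
  assert (Ec : forall x u, D (x, u) -> g x u = c x).
  { intros x u Dxu.
    destruct (epsilon_spec (inhabits 0) (fun y => exists u, D (x, u) /\ y = g x u))
      as [v [Dv Ev]]; [exists (g x u), u; auto|].
    unfold c. rewrite Ev. apply const; auto. }
  exists c. split; [|exact Ec].
  intros x [u Dxu].
  (* The chosen point may jump with [x], but its choice does not affect the value, so [c] can be
     computed near [x] at one fixed height [u]. *)
  apply (continuous_ext_loc _ (fun t => g t u)).
  - generalize (proj1 (locally_slices D x u D_open Dxu)). apply filter_imp.
    intros t Dt. apply Ec, Dt.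
  - apply (continuous_plus (fun t => second_derivative phi t u) (fun t => kappa t * u)).
    + apply (second_derivative_continuous D); auto.
    + apply (continuous_mult kappa (fun _ => u)); [|apply continuous_const].
      apply (kappa_continuous D phi); auto. exists u. exact Dxu.
Qed.

(** * Membership in the affine space S *)

Lemma solution_interval_in_proj (D : R * R -> Prop) (phi : R -> R -> R)
    (J : R -> Prop) (u : R -> R) (x : R) :
  is_solution D phi J u -> J x -> proj_x D x.
Proof. intros [_ [_ H]] Jx. exists (u x). apply H, Jx. Qed.

(** Take [v] in the kernel on all of [I] with the value and slope of u - up at a point of [J]. Then
    u - (up + v) solves the homogeneous equation on [J] with zero data, hence vanishes there. *)
Lemma L_eq_agree_affine (kappa c : R -> R) (I J : R -> Prop) (up u : R -> R) :
  open I -> is_connected I -> open J -> is_connected J -> (forall x, J x -> I x) ->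
  continuous_on_open I kappa ->
  L_eq kappa c I up -> L_eq kappa c J u ->
  exists w, affine_S kappa I up w /\ forall x, J x -> u x = w x.
Proof.
  intros Io Ic Jo Jc JI Hk Hup Hu.
  destruct (classic (exists x0, J x0)) as [[x0 J0]|N].
  - destruct (linear_exists I kappa (fun _ => 0) x0 (u x0 - up x0)
                (Derive u x0 - Derive up x0)) as [v [Hv [v0 dv0]]]; auto.
    { intros x _. apply continuous_const. }
    exists (fun x => up x + v x). split; [exists v; split; [exact Hv|reflexivity]|].
    intros x Jx. apply Rminus_diag_uniq.
    apply (linear_unique J x0 kappa (fun t => u t - (up t + v t))
             (fun t => Derive u t - (Derive up t + Derive v t))); auto.
    + intros t Jt. apply Hk, JI, Jt.
    + rewrite v0. ring.
    + rewrite dv0. ring.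
    + intros t Jt.
      destruct (L_eq_elim _ _ _ _ Hu t Jt) as [u1 u2].
      destruct (L_eq_elim _ _ _ _ Hup t (JI t Jt)) as [p1 p2].
      destruct (L_eq_elim _ _ _ _ Hv t (JI t Jt)) as [v1 v2].
      split.
      * apply @is_derive_minus; [exact u1|apply @is_derive_plus; auto].
      * replace (- kappa t * (u t - (up t + v t)))
          with ((c t - kappa t * u t)
                - ((c t - kappa t * up t) + (0 - kappa t * v t))) by ring.
        apply @is_derive_minus; [exact u2|apply @is_derive_plus; auto].
  (* [J] may be empty; then [up] itself, with v = 0, agrees with [u] on it vacuously. *)
  - exists up. split.
    + exists (fun _ => 0). split; [|intros; ring].
      apply (L_eq_intro _ _ _ _ (fun _ => 0) Io). intros x _.
      replace (0 - kappa x * 0) with 0 by ring.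
      split; apply @is_derive_const.
    + intros x Jx. exfalso. apply N. exists x. exact Jx.
Qed.

Lemma L_eq_of_affine (kappa c : R -> R) (I J : R -> Prop) (up w u : R -> R) :
  open J -> (forall x, J x -> I x) -> L_eq kappa c I up ->
  affine_S kappa I up w -> (forall x, J x -> u x = w x) -> L_eq kappa c J u.
Proof.
  intros Jo JI Hup [v [Hv Ew]] Eu.
  apply (L_eq_intro _ _ _ _ (fun x => Derive up x + Derive v x) Jo).
  intros x Jx.
  destruct (L_eq_elim _ _ _ _ Hup x (JI x Jx)) as [p1 p2].
  destruct (L_eq_elim _ _ _ _ Hv x (JI x Jx)) as [v1 v2].
  split.
  - apply (is_derive_ext_loc (fun t => up t + v t)).
    + generalize (Jo x Jx). apply filter_imp. intros t Jt.
      rewrite (Eu t Jt), (Ew t (JI t Jt)). reflexivity.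
    + apply @is_derive_plus; auto.
  - rewrite (Eu x Jx), (Ew x (JI x Jx)).
    replace (c x - kappa x * (up x + v x))
      with ((c x - kappa x * up x) + (0 - kappa x * v x)) by ring.
    apply @is_derive_plus; auto.
Qed.

Theorem proposition4p1 (D : R * R -> Prop) (phi : R -> R -> R) (kappa : R -> R)
  (D_open : open D)
  (D_fibers : forall x, is_connected (fun u => D (x, u)))
  (I_interval : is_connected (proj_x D))
  (phi_smooth : C2_on D phi) :
  ((forall x u, D (x, u) -> curvature phi x u = kappa x) <->
   (exists c : R -> R, continuous_on_open (proj_x D) c /\
      forall J u, is_solution D phi J u -> L_eq kappa c J u))
  /\
  (forall c : R -> R, continuous_on_open (proj_x D) c ->
     ((forall J u, is_solution D phi J u -> L_eq kappa c J u) <->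
      ((exists up, L_eq kappa c (proj_x D) up) /\
       (forall up, L_eq kappa c (proj_x D) up ->
          solutions_in_S D phi kappa up)))).
Proof.
  assert (Io := proj_x_open D D_open).
  split; [split|].
  - intros H.
    destruct (identity_of_curvature D phi kappa) as [c [Hc E]]; auto.
    exists c. split; [exact Hc|]. apply solutions_L_eq_iff; auto.
  - intros [c [_ H]]. apply (curvature_of_identity D phi kappa c D_open phi_smooth).
    apply solutions_L_eq_iff; auto.
  - intros c Hc. split.
    + intros H.
      (* Nothing is assumed about the regularity of [kappa]: its continuity comes from the first
         equivalence, since it equals the curvature. *)
      assert (Hk : continuous_on_open (proj_x D) kappa).
      { apply (kappa_continuous D phi); auto.
        apply (curvature_of_identity D phi kappa c D_open phi_smooth).
        apply solutions_L_eq_iff; auto. }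
      split.
      (* Initial data need a base point; if [D] is empty, any function is a particular solution. *)
      * destruct (classic (exists x0, proj_x D x0)) as [[x0 I0]|N].
        -- destruct (linear_exists (proj_x D) kappa c x0 0 0) as [up [Hup _]]; auto.
           exists up. exact Hup.
        -- exists (fun _ => 0). intros x Ix. exfalso. apply N. exists x. exact Ix.
      * intros up Hup J u Hu.
        apply (L_eq_agree_affine kappa c (proj_x D) J); auto; try apply Hu.
        intros x. apply (solution_interval_in_proj D phi J u x Hu).
    + intros [[up Hup] H] J u Hu.
      destruct (H up Hup J u Hu) as [w [Hw E]].
      apply (L_eq_of_affine kappa c (proj_x D) J up w u (proj1 Hu)); auto.
      intros x. apply (solution_interval_in_proj D phi J u x Hu).
Qed.
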